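(* Let $n\ge2$ and let $(L,[\cdot,\dots,\cdot],\varepsilon,\alpha)$ be a regular $n$-Hom-Lie color algebra. Then $L_{\alpha^{-1}}=(L,\{\cdot,\dots,\cdot\},\varepsilon)$, where $\{x_1,\dots,x_n\}=\alpha^{-1}([x_1,\dots,x_n])$, is an $n$-Lie color algebra.
   Context: $G$ is an abelian group with neutral element $e$ (operation written $+$), $\mathbb{K}$ is a field of characteristic different from 2. A $G$-graded linear space is $V=\bigoplus_{a\in G}V_a$ over $\mathbb{K}$; $\mathcal{H}(V)$ is its set of homogeneous elements; a linear map $f:V\to V'$ is even if $f(V_a)\subseteq V'_a$ for all $a$. A (skew-symmetric) bicharacter is a map $\varepsilon:G\times G\to\mathbb{K}^*$ with $\varepsilon(a,b)\varepsilon(b,a)=1$, $\varepsilon(a,b+c)=\varepsilon(a,b)\varepsilon(a,c)$, $\varepsilon(a+b,c)=\varepsilon(a,c)\varepsilon(b,c)$. For homogeneous $x,y$ one writes $\varepsilon(x,y)$ for $\varepsilon(\deg x,\deg y)$, and sums of homogeneous elements inside $\varepsilon$ denote sums of their degrees. An $n$-Hom-Lie color algebra $(L,[\cdot,\dots,\cdot],\varepsilon,\alpha)$ is a $G$-graded linear space $L$ with an $n$-linear map $[\cdot,\dots,\cdot]:L^n\to L$, a bicharacter $\varepsilon$ and an even linear map $\alpha:L\to L$ such that for all $x_i,y_j\in\mathcal{H}(L)$: (1) $[x_1,\dots,x_i,x_{i+1},\dots,x_n]=-\varepsilon(x_i,x_{i+1})[x_1,\dots,x_{i+1},x_i,\dots,x_n]$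 for $1\le i\le n-1$; (2) $[\alpha(x_1),\dots,\alpha(x_{n-1}),[y_1,\dots,y_n]]=\sum_{i=1}^n\varepsilon(X,Y_i)[\alpha(y_1),\dots,\alpha(y_{i-1}),[x_1,\dots,x_{n-1},y_i],\alpha(y_{i+1}),\dots,\alpha(y_n)]$, where $X=x_1+\dots+x_{n-1}$, $Y_i=y_1+\dots+y_{i-1}$ (sums of degrees, $Y_1=e$). An $n$-Lie color algebra is the case $\alpha=\mathrm{id}$. An $n$-Hom-Lie color algebra is regular if $\alpha$ is an automorphism, i.e. bijective with $\alpha([x_1,\dots,x_n])=[\alpha(x_1),\dots,\alpha(x_n)]$. *)

(* Defs.v *)
From HB Require Import structures.
From mathcomp Require Import all_boot all_order all_algebra all_fingroup.

Set Implicit Arguments.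
Unset Strict Implicit.
Unset Printing Implicit Defensive.

Import GRing.Theory.
Local Open Scope ring_scope.

(* L is the internal direct sum of the subspaces [L_ a], a : G. *)
Record is_grading (G : zmodType) (K : fieldType) (L : lmodType K)
    (L_ : G -> L -> Prop) : Prop := IsGrading {
  grading0 : forall a, L_ a 0;
  gradingP : forall a (k : K) (u v : L), L_ a u -> L_ a v -> L_ a (k *: u + v);
  grading_span : forall v : L, exists (s : seq G) (w : G -> L),
    (forall a, L_ a (w a)) /\ v = \sum_(a <- s) w a;
  grading_direct : forall (s : seq G) (w : G -> L),
    uniq s -> (forall a, L_ a (w a)) -> \sum_(a <- s) w a = 0 ->
    forall a, a \in s -> w a = 0
}.

Definition even_map (G : zmodType) (K : fieldType) (L L' : lmodType K)
    (L_ : G -> L -> Prop) (L'_ : G -> L' -> Prop) (f : L -> L') : Prop :=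
  forall a v, L_ a v -> L'_ a (f v).

Record is_bicharacter (G : zmodType) (K : fieldType) (eps : G -> G -> K) : Prop :=
  IsBicharacter {
  bichar_neq0 : forall a b, eps a b != 0;
  bichar_skew : forall a b, eps a b * eps b a = 1;
  bicharDr : forall a b c, eps a (b + c) = eps a b * eps a c;
  bicharDl : forall a b c, eps (a + b) c = eps a c * eps b c
}.

Definition replace_at (n : nat) (T : Type) (x : {ffun 'I_n -> T}) (i : 'I_n)
    (v : T) : {ffun 'I_n -> T} :=
  [ffun j => if j == i then v else x j].

(* (x_1, .., x_(n-1), z): [insub j] is [Some] of j seen in 'I_n.-1 when
   j < n.-1, and [None] when j is the last index. *)
Definition append_last (n : nat) (T : Type) (x : {ffun 'I_n.-1 -> T}) (z : T) :
    {ffun 'I_n -> T} :=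
  [ffun j : 'I_n => if (insub (val j) : option 'I_n.-1) is Some k then x k else z].

Definition multilinear (n : nat) (K : fieldType) (L : lmodType K)
    (br : {ffun 'I_n -> L} -> L) : Prop :=
  forall (x : {ffun 'I_n -> L}) (i : 'I_n) (k : K) (u v : L),
    br (replace_at x i (k *: u + v)) =
    k *: br (replace_at x i u) + br (replace_at x i v).

(* Homogeneous arguments come with degrees [dx], [dy]; only the zero vector has
   several degrees, and for it both sides of the identities vanish. *)
Record is_nHomLieColor (n : nat) (G : zmodType) (K : fieldType)
    (L : lmodType K) (L_ : G -> L -> Prop) (br : {ffun 'I_n -> L} -> L)
    (eps : G -> G -> K) (alpha : {linear L -> L}) : Prop := IsNHomLieColor {
  nHLC_grading : is_grading L_;
  nHLC_multilinear : multilinear br;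
  nHLC_bichar : is_bicharacter eps;
  nHLC_even : even_map L_ L_ alpha;
  nHLC_skew : forall (x : {ffun 'I_n -> L}) (dx : 'I_n -> G),
    (forall i, L_ (dx i) (x i)) ->
    forall i j : 'I_n, j = i.+1 :> nat ->
    br x = - (eps (dx i) (dx j) *: br [ffun k => x (tperm i j k)]);
  nHLC_jacobi : forall (x : {ffun 'I_n.-1 -> L}) (y : {ffun 'I_n -> L})
      (dx : 'I_n.-1 -> G) (dy : 'I_n -> G),
    (forall i, L_ (dx i) (x i)) -> (forall i, L_ (dy i) (y i)) ->
    br (append_last [ffun i => alpha (x i)] (br y)) =
    \sum_(i < n)
      eps (\sum_(k < n.-1) dx k) (\sum_(j < n | (j < i)%N) dy j) *:
        br (replace_at [ffun j => alpha (y j)] i (br (append_last x (y i))))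
}.

Definition is_nLieColor (n : nat) (G : zmodType) (K : fieldType)
    (L : lmodType K) (L_ : G -> L -> Prop) (br : {ffun 'I_n -> L} -> L)
    (eps : G -> G -> K) : Prop :=
  is_nHomLieColor L_ br eps (idfun : {linear L -> L}).

Record is_regular_nHomLieColor (n : nat) (G : zmodType) (K : fieldType)
    (L : lmodType K) (L_ : G -> L -> Prop) (br : {ffun 'I_n -> L} -> L)
    (eps : G -> G -> K) (alpha : {linear L -> L}) : Prop := IsRegularNHomLieColor {
  regular_nHLC : is_nHomLieColor L_ br eps alpha;
  regular_bij : bijective alpha;
  regular_morph : forall x : {ffun 'I_n -> L},
    alpha (br x) = br [ffun i => alpha (x i)]
}.

(* Main.v *)
(* By multiplicativity, alpha carries each bracket to the bracket of the images,
   so that alpha^2 maps the Jacobi identity of the twisted bracket to the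
   Hom-Jacobi identity at the same arguments; conclude by injectivity. *)
Require Import Defs.
From HB Require Import structures.
From mathcomp Require Import all_boot all_order all_algebra all_fingroup.

Set Implicit Arguments.
Unset Strict Implicit.
Unset Printing Implicit Defensive.

Import GRing.Theory.
Local Open Scope ring_scope.

Lemma map_replace_at (n : nat) (T U : Type) (f : T -> U) (x : {ffun 'I_n -> T})
    (i : 'I_n) (v : T) :
  [ffun j => f (replace_at x i v j)] = replace_at [ffun j => f (x j)] i (f v).
Proof. by apply/ffunP=> j; rewrite !ffunE; case: eqP. Qed.

Lemma map_append_last (n : nat) (T U : Type) (f : T -> U)
    (x : {ffun 'I_n.-1 -> T}) (z : T) :
  [ffun j => f (append_last x z j)] = append_last [ffun i => f (x i)] (f z).
Proof. by apply/ffunP=> j; rewrite !ffunE; case: insub => // k; rewrite ffunE. Qed.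

Theorem corollary3p7 (n : nat) (G : zmodType) (K : fieldType) (L : lmodType K)
    (L_ : G -> L -> Prop) (br : {ffun 'I_n -> L} -> L) (eps : G -> G -> K)
    (alpha : {linear L -> L}) (alphaV : L -> L) :
  (2 <= n)%N ->
  2%N \notin [pchar K] ->
  is_regular_nHomLieColor L_ br eps alpha ->
  cancel alpha alphaV -> cancel alphaV alpha ->
  is_nLieColor L_ (fun x => alphaV (br x)) eps.
Proof.
move=> _ _ [[gr ml bi _ skew jac] _ morph] alphaK alphaVK.
have alphaI := can_inj alphaK.
split=> //.
(* Applying the injective linear map [alpha] cancels [alphaV] and leaves the same law for [br];
   skew-symmetry goes likewise. *)
- by move=> x i k u v; apply: alphaI; rewrite linearP /= !alphaVK ml.
- move=> x dx hx i j ij; apply: alphaI.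
  by rewrite linearN linearZ /= !alphaVK; apply: skew.
- move=> x y dx dy hx hy.
  have ffun_id m (z : {ffun 'I_m -> L}) : [ffun i => idfun (z i)] = z.
    by apply/ffunP=> i; rewrite ffunE.
  (* One [alpha] cancels the outer [alphaV]; the other enters [br] by [morph], twists the arguments
     and cancels the inner [alphaV]. *)
  rewrite !ffun_id; do 2!apply: (alphaI).
  rewrite alphaVK morph map_append_last alphaVK (jac x y dx dy hx hy) !linear_sum.
  apply: eq_bigr => i _.
  (* The [eps] scalars come out by linearity; each summand becomes its Hom-Jacobi term. *)
  by rewrite !linearZ /= alphaVK morph map_replace_at alphaVK.
Qed.
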